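(* Let $a,b,j$ be integers with $a,b\geq 1$ and $j\geq 2$. Then $$\sum_{k\geq 1}{a+b+1\brack k-1}_q B_{k,a}^{(j)}(q)=\sum_{k\geq 1}{a+b+1\brack k-1}_q B_{k,b}^{(j)}(q),$$ where $B_{n,k}^{(j)}(q)$ denotes the restricted $q$-Eulerian numbers.
   Context: Notation: $(q;q)_n=\prod_{i=1}^n(1-q^i)$, $(q;q)_0=1$; $e(z;q)=\sum_{n\ge 0}\frac{z^n}{(q;q)_n}$; the $q$-binomial coefficient is ${n\brack k}_q=\frac{(q;q)_n}{(q;q)_{n-k}(q;q)_k}$ for $0\le k\le n$, and ${n\brack k}_q=0$ if $k<0$ or $k>n$. All generating functions are formal power series in $z$. The $(q,r)$-Eulerian polynomials $A_n(t,r,q)$, $n\ge 0$, are defined by $$\sum_{n\ge 0}A_n(t,r,q)\frac{z^n}{(q;q)_n}=\frac{(1-t)e(rz;q)}{e(tz;q)-te(z;q)},$$ and $A_n(t,q):=A_n(t,1,q)$. For $1\le j\le n$ the restricted $q$-Eulerian polynomials $B_n^{(j)}(t,q)$ are defined by $$\sum_{n\ge j}B_n^{(j)}(t,q)\frac{z^{n-1}}{(q;q)_{n-1}}=\left(\frac{A_{j-1}(t,q)(qz)^{j-1}}{(q;q)_{j-1}}\right)\frac{e(tz;q)-te(tz;q)}{e(tz;q)-te(z;q)},$$ and the restricted $q$-Eulerian numbers $B_{n,k}^{(j)}(q)$ by $B_n^{(j)}(t,q)=\sum_k B_{n,k}^{(j)}(q)t^k$. Convention: $B_{n,k}^{(j)}(q)=0$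 when $n<j$. *)

(* Defs.v *)
From mathcomp Require Import all_boot all_algebra.

Set Implicit Arguments.
Unset Strict Implicit.
Unset Printing Implicit Defensive.

Import GRing.Theory.
Local Open Scope ring_scope.

(* MathComp has no formal power series; a series in z is its coefficient
   sequence.  Pointwise multiplication of functions is never used. *)
Section FormalPowerSeries.
Variable F : fieldType.

Definition fps := nat -> F.

Implicit Types f g : fps.

Definition fps_sub f g : fps := fun n => f n - g n.

Definition fps_scale (c : F) f : fps := fun n => c * f n.

Definition fps_mul f g : fps := fun n => \sum_(i < n.+1) f i * g (n - i)%N.

Definition fps_monomial (c : F) (m : nat) : fps :=
  fun n => if n == m then c else 0.

(* The first n coefficients of 1 / g, for g 0 <> 0. *)
Fixpoint fps_inv_prefix g (n : nat) : seq F :=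
  if n is m.+1 then
    let s := fps_inv_prefix g m in
    rcons s ((g 0%N)^-1 * ((m == 0)%:R - \sum_(i < m) s`_i * g (m - i)%N))
  else [::].

Definition fps_inv g : fps := fun n => (fps_inv_prefix g n.+1)`_n.

Definition fps_div f g : fps := fps_mul f (fps_inv g).

Lemma size_fps_inv_prefix g n : size (fps_inv_prefix g n) = n.
Proof. by elim: n => //= n IHn; rewrite size_rcons IHn. Qed.

Lemma nth_fps_inv_prefix g n i :
  (i < n)%N -> (fps_inv_prefix g n)`_i = fps_inv g i.
Proof.
elim: n => // n IHn; rewrite ltnS leq_eqVlt => /predU1P[->|lt_in] //.
by rewrite /= nth_rcons size_fps_inv_prefix lt_in IHn.
Qed.

Lemma fps_invE g n :
  fps_inv g n =
    (g 0%N)^-1 * ((n == 0)%:R - \sum_(i < n) fps_inv g i * g (n - i)%N).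
Proof.
rewrite {1}/fps_inv /= nth_rcons size_fps_inv_prefix ltnn eqxx.
by congr (_ * (_ - _)); apply: eq_bigr => i _; rewrite nth_fps_inv_prefix.
Qed.

Lemma fps_mulVf g :
  g 0%N != 0 -> fps_mul (fps_inv g) g =1 fps_monomial 1 0.
Proof.
move=> g0 n; rewrite /fps_mul big_ord_recr /= subnn fps_invE mulrC mulrA.
rewrite divff // mul1r addrC subrK /fps_monomial.
by case: (n == 0%N).
Qed.

End FormalPowerSeries.

Section Eulerian.
Variable F : fieldType.
Implicit Types q t r c : F.

Definition qpoch q (n : nat) : F := \prod_(1 <= i < n.+1) (1 - q ^+ i).

Definition qbinom q (n k : nat) : F :=
  if (k <= n)%N then qpoch q n / (qpoch q (n - k) * qpoch q k) else 0.

(* e(cz; q) *)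
Definition qexp q c : fps F := fun n => c ^+ n / qpoch q n.

(* e(tz; q) - t e(z; q) *)
Definition eulerian_den q t : fps F :=
  fps_sub (qexp q t) (fps_scale t (qexp q 1)).

Definition eulerian_gf q t r : fps F :=
  fps_div (fps_scale (1 - t) (qexp q r)) (eulerian_den q t).

(* A_n(t, r, q) *)
Definition qr_eulerian q t r (n : nat) : F :=
  qpoch q n * eulerian_gf q t r n.

(* A_n(t, q) *)
Definition q_eulerian q t (n : nat) : F := qr_eulerian q t 1 n.

Definition restricted_gf q t (j : nat) : fps F :=
  fps_mul
    (fps_monomial (q_eulerian q t j.-1 * q ^+ j.-1 / qpoch q j.-1) j.-1)
    (fps_div (fps_sub (qexp q t) (fps_scale t (qexp q t)))
       (eulerian_den q t)).

(* B_n^(j)(t, q), for j >= 1 *)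
Definition restricted_eulerian q t (j n : nat) : F :=
  if (n < j)%N then 0 else qpoch q n.-1 * restricted_gf q t j n.-1.

End Eulerian.

(* Q(q), with q an indeterminate, so that every (q; q)_n is invertible. *)
Definition Kq : fieldType := {fraction {poly rat}}.
Definition qvar : Kq := tofrac 'X.

(* Q(q)(t): the quotients above need 1 - t to be invertible. *)
Definition Kqt : fieldType := {fraction {poly Kq}}.
Definition cst_t (c : Kq) : Kqt := tofrac c%:P.
Definition tvar : Kqt := tofrac 'X.

(* The polynomial in t equal to x, when x is one (see poly_partE); on other
   rational functions, the polynomial part. *)
Definition poly_part (x : Kqt) : {poly Kq} :=
  (frac (repr x)).1 %/ (frac (repr x)).2.

Lemma poly_partE (p : {poly Kq}) : poly_part (tofrac p) = p.
Proof.
rewrite /poly_part; set x := repr _.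
have nz : (frac x).2 != 0 by exact: denom_ratioP.
suff -> : (frac x).1 = p * (frac x).2 by rewrite mulpK.
have: (x == Ratio p 1 %[mod {fraction {poly Kq}}])%qT.
  by rewrite reprK piE.
rewrite FracField.equivf_def !numden_Ratio ?oner_neq0 //.
by rewrite mulr1 => /eqP ->; rewrite mulrC.
Qed.

Lemma tofrac_sum (I : Type) (s : seq I) (P : pred I) (f : I -> Kqt) :
    (forall i, P i -> exists p, f i = tofrac p) ->
  exists p, \sum_(i <- s | P i) f i = tofrac p.
Proof.
move=> fP; elim/big_ind: _ => [|_ _ [p ->] [p' ->]|]; last exact: fP.
  by exists 0; rewrite tofrac0.
by exists (p + p'); rewrite tofracD.
Qed.

Lemma qpoch_cst n : qpoch (cst_t qvar) n = cst_t (qpoch qvar n).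
Proof.
rewrite /qpoch -[RHS]/((@tofrac {poly Kq} \o polyC) _) rmorph_prod.
by apply: eq_bigr => i _; rewrite rmorphB rmorphXn rmorph1.
Qed.

Lemma qpoch_cstV n : (qpoch (cst_t qvar) n)^-1 = cst_t (qpoch qvar n)^-1.
Proof.
by rewrite qpoch_cst -[RHS]/((@tofrac {poly Kq} \o polyC) _) fmorphV.
Qed.

Lemma sub1tvar_neq0 : 1 - tvar != 0.
Proof.
rewrite subr_eq0 -tofrac1 tofrac_eq; apply/eqP => /(congr1 (coefp 0)).
by rewrite /= coef1 coefX => /eqP; rewrite oner_eq0.
Qed.

Lemma eulerian_den0 (q : Kqt) : eulerian_den q tvar 0 = 1 - tvar.
Proof.
rewrite /eulerian_den /fps_sub /fps_scale /qexp /qpoch big_nil.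
by rewrite !expr0 divr1 mulr1.
Qed.

(* 1 - t divides every coefficient of e(tz; q) - t e(z; q). *)
Lemma eulerian_den_dvd n :
  exists p, eulerian_den (cst_t qvar) tvar n = (1 - tvar) * tofrac p.
Proof.
case: n => [|n]; first by exists 1; rewrite eulerian_den0 tofrac1 mulr1.
exists (- ('X * \sum_(i < n) 'X^i) * ((qpoch qvar n.+1)^-1)%:P).
rewrite /eulerian_den /fps_sub /fps_scale /qexp expr1n qpoch_cstV mul1r -mulrBl.
rewrite tofracM mulrA; congr (_ * _).
rewrite -tofrac1 /tvar -tofracXn -!tofracB -tofracM; congr tofrac.
by rewrite exprS -[X in _ - X]mulr1 -mulrBr subrX1 mulrN mulrCA -mulNr opprB.
Qed.

Lemma fps_div_eulerian_den_poly (f : fps Kqt) :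
    (forall n, exists p, f n = (1 - tvar) * tofrac p) ->
  forall n, exists p, fps_div f (eulerian_den (cst_t qvar) tvar) n = tofrac p.
Proof.
move=> fP; set d := eulerian_den _ _; have nz := sub1tvar_neq0.
have iP n : exists p, (1 - tvar) * fps_inv d n = tofrac p.
  elim/ltn_ind: n => n IHn; rewrite fps_invE /d eulerian_den0 mulVKf //.
  have [i|p ->] := @tofrac_sum _ (index_enum 'I_n) predT
    (fun i => fps_inv d i * d (n - i)%N).
    move=> _; have [p dE] := eulerian_den_dvd (n - i).
    have [p' iE] := IHn i (ltn_ord i).
    by exists (p' * p); rewrite /d dE mulrCA mulrA -/d iE tofracM.
  by exists ((n == 0%N)%:R - p); rewrite tofracB rmorph_nat.
move=> n; apply: tofrac_sum => i _.
have [p ->] := fP i; have [p' iE] := iP (n - i)%N.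
by exists (p * p'); rewrite mulrAC iE tofracM mulrC.
Qed.

Lemma q_eulerian_poly n :
  exists p, q_eulerian (cst_t qvar) tvar n = tofrac p.
Proof.
rewrite /q_eulerian /qr_eulerian /eulerian_gf.
have [m|p ->] := @fps_div_eulerian_den_poly
  (fps_scale (1 - tvar) (qexp (cst_t qvar) 1)) _ n.
  exists ((qpoch qvar m)^-1)%:P.
  by rewrite /fps_scale /qexp expr1n mul1r qpoch_cstV.
by exists ((qpoch qvar n)%:P * p); rewrite qpoch_cst tofracM.
Qed.

(* So taking the coefficient of t^k below loses nothing. *)
Lemma restricted_eulerian_poly j n :
  exists p, restricted_eulerian (cst_t qvar) tvar j n = tofrac p.
Proof.
rewrite /restricted_eulerian /restricted_gf /fps_mul.
case: ltnP => _; first by exists 0; rewrite tofrac0.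
have [i|p ->] := @tofrac_sum _ (index_enum 'I_n.-1.+1) predT
  (fun i => fps_monomial (q_eulerian (cst_t qvar) tvar j.-1 * cst_t qvar ^+ j.-1
      / qpoch (cst_t qvar) j.-1) j.-1 i *
    fps_div (fps_sub (qexp (cst_t qvar) tvar)
      (fps_scale tvar (qexp (cst_t qvar) tvar)))
      (eulerian_den (cst_t qvar) tvar) (n.-1 - i)%N).
  move=> _; set f := fps_sub _ _.
  have [m|p ->] := @fps_div_eulerian_den_poly f _ (n.-1 - i)%N.
    exists ('X^m * ((qpoch qvar m)^-1)%:P).
    rewrite /f /fps_sub /fps_scale /qexp qpoch_cstV tofracM tofracXn.
    by rewrite mulrBl mul1r.
  rewrite /fps_monomial; case: eqP => _.
    have [p' ->] := q_eulerian_poly j.-1.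
    exists (p' * qvar%:P ^+ j.-1 * ((qpoch qvar j.-1)^-1)%:P * p).
    by rewrite qpoch_cstV !tofracM tofracXn.
  by exists 0; rewrite mul0r tofrac0.
by exists ((qpoch qvar n.-1)%:P * p); rewrite qpoch_cst tofracM.
Qed.

(* B_{n,k}^(j)(q), the coefficient of t^k in B_n^(j)(t, q) *)
Definition restricted_eulerian_number (j n k : nat) : Kq :=
  (poly_part (restricted_eulerian (cst_t qvar) tvar j n))`_k.

(* Main.v *)
Require Import Defs.
From HB Require Import structures.
From mathcomp Require Import all_boot all_algebra.

Set Implicit Arguments.
Unset Strict Implicit.

Import GRing.Theory.
Local Open Scope ring_scope.

(** The theorem is the palindromicity of a polynomial in [t].  Put [N = a + b + 1]
    and multiply the generating function of the [B_n^(j)(t, q)] by [e(z; q)]: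
    the polynomial
      [F_N(t) = \sum_n [N, n]_q B_(n+1)^(j)(t, q)]
    is [(q; q)_N] times the coefficient of [z^N] in
      [M(z) * (e(z) e(tz)) * W(z)],  [W(z) = (1 - t) / (e(tz) - t e(z))],
    where [M(z)] is the single term [A_(j-1)(t, q) (qz)^(j-1) / (q; q)_(j-1)]
    ([restricted_eulerian_transform]).  The two sides of the theorem are the
    coefficients of [t^a] and [t^b] in [F_N], so it suffices that
    [t^(N-1) F_N(1/t) = F_N(t)], because [a + b = N - 1].

    Call [x] reciprocal of degree [n] when it is a polynomial in [t] with
    [t^n x(1/t) = x(t)]; degrees add under multiplication.  A series whose
    [z^n] coefficient is reciprocal of degree [n] for all [n] is one invariant
    under [(t, z) -> (1/t, tz)], and such series are closed under products and
    inverses.  This substitution exchanges [e(z)] and [e(tz)], so it fixes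
    [e(z) e(tz)]; it also fixes [W], whose numerator and denominator are both
    multiplied by [-1/t] ([qexp_mul_graded], [reduced_den_inv_graded]).

    The degree drops by one because of [M]: writing
      [e(z) = (e(z) - e(tz)) / (1 - t) + (e(tz) - t e(z)) / (1 - t)]
    gives [\sum_n A_n(t, q) z^n / (q; q)_n = 1 + (e(z) - e(tz)) / (1 - t) * W(z)],
    and the [z^n] coefficient [(1 + t + ... + t^(n-1)) / (q; q)_n] of the middle
    factor is reciprocal of degree [n - 1].  Hence [A_n] is reciprocal of degree
    [n - 1] for [n >= 1] ([q_eulerian_reciprocal]).  As [j >= 2], this applies
    to [A_(j-1)], and [F_N] is reciprocal of degree [N - 1]. *)

(** * Products of power series *)

Section SeriesAlgebra.
Variable F : fieldType.
Implicit Types f g h : fps F.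

(** Truncation to polynomials transports the ring laws of [{poly F}] to series;
    the bound [N] is independent of [n] so that one truncation serves all the
    coefficients of an iterated product. *)
Lemma fps_mul_coefM f g N n : (n <= N)%N ->
  fps_mul f g n = ((\poly_(i < N.+1) f i) * (\poly_(i < N.+1) g i))`_n.
Proof.
move=> le_nN; rewrite coefM; apply: eq_bigr => i _.
have le_iN : (i <= N)%N by rewrite (leq_trans _ le_nN) // -ltnS.
by rewrite !coef_poly !ltnS le_iN (leq_trans (leq_subr _ _) le_nN).
Qed.

Lemma eq_fps_mul f f' g g' :
  f =1 f' -> g =1 g' -> fps_mul f g =1 fps_mul f' g'.
Proof. by move=> ef eg n; apply: eq_bigr => i _; rewrite ef eg. Qed.

Lemma fps_mulC f g : fps_mul f g =1 fps_mul g f.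
Proof. by move=> n; rewrite !(@fps_mul_coefM _ _ n) // mulrC. Qed.

Lemma fps_mulA f g h : fps_mul f (fps_mul g h) =1 fps_mul (fps_mul f g) h.
Proof.
move=> n; set T := fun f => \poly_(i < n.+1) f i.
have TE f1 k : (k <= n)%N -> (T f1)`_k = f1 k by rewrite coef_poly ltnS => ->.
have tripleE f1 g1 h1 :
    fps_mul (fps_mul f1 g1) h1 n = (T f1 * T g1 * T h1)`_n.
  rewrite coefM; apply: eq_bigr => i _.
  by rewrite TE ?leq_subr // (@fps_mul_coefM _ _ n) // -ltnS.
by rewrite fps_mulC !tripleE mulrC mulrA.
Qed.

Lemma fps_mulCA f g h : fps_mul f (fps_mul g h) =1 fps_mul g (fps_mul f h).
Proof.
move=> n; rewrite !fps_mulA; apply: eq_fps_mul => //.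
exact: fps_mulC.
Qed.

Lemma fps_mul_scale c f g :
  fps_mul (fps_scale c f) g =1 fps_mul f (fps_scale c g).
Proof.
by move=> n; apply: eq_bigr => i _; rewrite /fps_scale mulrCA mulrA.
Qed.

End SeriesAlgebra.

(** * Reciprocal polynomials in t *)

HB.instance Definition _ := GRing.RMorphism.copy cst_t (@tofrac {poly Kq} \o polyC).

(** Evaluating [p] at [t^-1] inside the field of fractions, rather than
    reversing its coefficients, makes stability under sums and products
    immediate.  The equation [t^n p(1/t) = p(t)] forces [deg p <= n]. *)
Definition reciprocal (n : nat) (x : Kqt) : Prop :=
  exists2 p, x = tofrac p & x = tvar ^+ n * (map_poly cst_t p).[tvar^-1].

Lemma tvar_neq0 : tvar != 0.
Proof. by rewrite /tvar tofrac_eq0 polyX_eq0. Qed.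

Lemma reciprocal_coef n p a b :
  reciprocal n (tofrac p) -> (a + b = n)%N -> p`_a = p`_b.
Proof.
case=> p' /eqP; rewrite tofrac_eq => /eqP <- {p'} pE abn.
(* Multiplying by t^(size p) clears the negative powers of t, so that the
   identity can be read on coefficients of polynomials. *)
have: p * 'X^(size p) = \sum_(i < size p) p`_i *: 'X^(n + size p - i).
  apply/eqP; rewrite -tofrac_eq tofracM pE tofracXn -/tvar; apply/eqP.
  rewrite horner_coef size_map_poly mulr_sumr mulr_suml (rmorph_sum (@tofrac {poly Kq})) /=.
  apply: eq_bigr => i _; rewrite coef_map /= -mul_polyC tofracM tofracXn.
  rewrite exprB ?unitfE ?tvar_neq0 //; last first.
    by rewrite (leq_trans (ltnW (ltn_ord i))) ?leq_addl.
  rewrite -/tvar exprD exprVn.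
  by rewrite mulrCA -!mulrA [_^-1 * _]mulrC.
move/(congr1 (fun r : {poly Kq} => r`_(b + size p))).
rewrite coefMXn ltnNge leq_addl /= addnK coef_sum => ->.
have -> : \sum_(i < size p) (p`_i *: 'X^(n + size p - i))`_(b + size p)
   = \sum_(i < size p | i == a :> nat) p`_i.
  rewrite [RHS]big_mkcond; apply: eq_bigr => i _.
  rewrite coefZ coefXn -abn.
  have -> : (b + size p == a + b + size p - i)%N = (i == a :> nat).
    have lt_i := ltn_ord i.
    rewrite -(eqn_add2r i) subnK; last first.
      by rewrite (leq_trans (ltnW lt_i)) ?leq_addl.
    by rewrite -[(a + b + _)%N]addnA [(a + _)%N]addnC eqn_add2l.
  by case: eqP; rewrite ?mulr1 ?mulr0.
have [lt_a | le_a] := ltnP a (size p).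
  by rewrite (big_pred1 (Ordinal lt_a)).
rewrite big1 ?nth_default // => i /eqP ia.
by move: (ltn_ord i); rewrite ia ltnNge le_a.
Qed.

Lemma reciprocal0 n : reciprocal n 0.
Proof. by exists 0; rewrite ?tofrac0 // (rmorph0 (map_poly cst_t)) horner0 mulr0. Qed.

Lemma reciprocal_cst c : reciprocal 0 (cst_t c).
Proof. by exists c%:P => //; rewrite map_polyC hornerC mul1r. Qed.

Lemma reciprocalD n x y :
  reciprocal n x -> reciprocal n y -> reciprocal n (x + y).
Proof.
case=> p xp xE [r yr yE]; exists (p + r); first by rewrite tofracD -xp -yr.
by rewrite (rmorphD (map_poly cst_t)) hornerD mulrDr {1}xE {1}yE.
Qed.

Lemma reciprocalM m n x y :
  reciprocal m x -> reciprocal n y -> reciprocal (m + n) (x * y).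
Proof.
case=> p xp xE [r yr yE]; exists (p * r); first by rewrite tofracM -xp -yr.
by rewrite (rmorphM (map_poly cst_t)) hornerM exprD mulrACA {1}xE {1}yE.
Qed.

Lemma reciprocalZ n c x : reciprocal n x -> reciprocal n (cst_t c * x).
Proof. by move/(reciprocalM (reciprocal_cst c)). Qed.

Lemma reciprocalN n x : reciprocal n x -> reciprocal n (- x).
Proof. by move/(reciprocalZ (-1)); rewrite (rmorphN1 cst_t) mulN1r. Qed.

Lemma reciprocal_sum n (I : finType) (f : I -> Kqt) :
  (forall i, reciprocal n (f i)) -> reciprocal n (\sum_i f i).
Proof.
move=> fP; elim/big_rec: _ => [|i x _ xP]; first exact: reciprocal0.
exact: reciprocalD.
Qed.

(** Converse of [reciprocal_coef]; it is used for [1 + t + ... + t^n] and for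
    the coefficients of [e(z) e(tz)]. *)
Lemma reciprocal_symmetric n (c : nat -> Kq) :
    (forall i, (i <= n)%N -> c (n - i)%N = c i) ->
  reciprocal n (\sum_(i < n.+1) cst_t (c i) * tvar ^+ i).
Proof.
move=> csym; exists (\sum_(i < n.+1) c i *: 'X^i).
  rewrite (rmorph_sum (@tofrac {poly Kq})); apply: eq_bigr => i _.
  by rewrite /= -mul_polyC tofracM tofracXn.
rewrite (reindex_inj rev_ord_inj) (rmorph_sum (map_poly cst_t)) horner_sum mulr_sumr.
apply: eq_bigr => i _; have le_in : (i <= n)%N by rewrite -ltnS.
rewrite /= map_polyZ map_polyXn hornerZ hornerXn /= subSS csym // mulrCA.
by rewrite exprB ?unitfE ?tvar_neq0 // exprVn.
Qed.

Definition geom_t (n : nat) : Kqt := \sum_(i < n) tvar ^+ i.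

Lemma reciprocal_geom n : reciprocal n (geom_t n.+1).
Proof.
have := @reciprocal_symmetric n (fun=> 1) (fun _ _ => erefl).
by under eq_bigr do rewrite (rmorph1 cst_t) mul1r.
Qed.

(** Degree 2, since [t = t^2 * t^-1]. *)
Lemma reciprocal_tvar : reciprocal 2 tvar.
Proof.
exists 'X => //; rewrite map_polyX hornerX expr2 mulfK //.
exact: tvar_neq0.
Qed.

(** * Series with reciprocal coefficients *)

Definition graded (f : fps Kqt) : Prop := forall n, reciprocal n (f n).

(** The product of [z] and a graded series. *)
Definition shift_graded (f : fps Kqt) : Prop :=
  f 0%N = 0 /\ forall n, reciprocal n (f n.+1).

Lemma graded_mul f g : graded f -> graded g -> graded (fps_mul f g).
Proof.
move=> fP gP n; apply: reciprocal_sum => i.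
by have := reciprocalM (fP i) (gP (n - i)%N); rewrite subnKC // -ltnS.
Qed.

Lemma shift_graded_mul f g :
  shift_graded f -> graded g -> shift_graded (fps_mul f g).
Proof.
case=> f0 fP gP; split=> [|n]; first by rewrite /fps_mul big_ord1 f0 mul0r.
rewrite /fps_mul big_ord_recl f0 mul0r add0r.
apply: reciprocal_sum => i; rewrite lift0 subSS.
by have := reciprocalM (fP i) (gP (n - i)%N); rewrite subnKC // -ltnS.
Qed.

(** * The series attached to the q-Eulerian polynomials *)

Local Notation qt := (cst_t qvar).
Local Notation den := (eulerian_den qt tvar).

(** [(e(tz) - t e(z)) / (1 - t)], with the division carried out:
    [(t^n - t) / (1 - t) = - t (1 + ... + t^(n-2))] for [n >= 1]. *)
Definition reduced_den : fps Kqt := fun n =>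
  if n is m.+1 then - (tvar * geom_t m / qpoch qt n) else 1.

(** [(e(z) - e(tz)) / (1 - t)]. *)
Definition reduced_num : fps Kqt := fun n => geom_t n / qpoch qt n.

Definition reduced_den_inv : fps Kqt := fps_scale (1 - tvar) (fps_inv den).

Lemma geom_tE n : (1 - tvar) * geom_t n = 1 - tvar ^+ n.
Proof. by rewrite -[1 - tvar ^+ n]opprB subrX1 -mulNr opprB. Qed.

Lemma reduced_denE n : den n = (1 - tvar) * reduced_den n.
Proof.
case: n => [|n]; first by rewrite eulerian_den0 mulr1.
rewrite /eulerian_den /fps_sub /fps_scale /qexp expr1n /reduced_den mul1r.
rewrite -mulrBl mulrN 2!mulrA [_ * tvar]mulrC -[_ * _ * geom_t _]mulrA.
rewrite geom_tE -mulNr; congr (_ / _).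
by rewrite mulrBr mulr1 -exprS opprB.
Qed.

Lemma qexp1_split n : qexp qt 1 n = reduced_num n + reduced_den n.
Proof.
case: n => [|n]; rewrite /qexp /reduced_num /reduced_den expr1n.
  by rewrite /geom_t big_ord0 [in RHS]mul0r [RHS]add0r /qpoch big_nil divr1.
rewrite -mulrBl /geom_t big_ord_recl expr0 -addrA mulr_sumr.
congr (_ / _); rewrite -[LHS]addr0; congr (_ + _).
by rewrite -sumrB big1 // => i _; rewrite exprS subrr.
Qed.

Lemma reciprocal_qpochV n x m :
  reciprocal n x -> reciprocal n (x / qpoch qt m).
Proof. by rewrite qpoch_cstV mulrC; exact: reciprocalZ. Qed.

Lemma reduced_den_graded : graded reduced_den.
Proof.
case=> [|[|n]] /=.
- by rewrite -(rmorph1 cst_t); exact: reciprocal_cst.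
- rewrite /geom_t big_ord0 mulr0 mul0r oppr0; exact: reciprocal0.
apply/reciprocalN/reciprocal_qpochV.
exact: (reciprocalM reciprocal_tvar (reciprocal_geom n)).
Qed.

Lemma reduced_num_shift_graded : shift_graded reduced_num.
Proof.
split=> [|n]; first by rewrite /reduced_num /geom_t big_ord0 mul0r.
exact/reciprocal_qpochV/reciprocal_geom.
Qed.

(** The recursion defining the inverse of a series preserves gradedness, as
    the constant coefficient of [reduced_den] is 1. *)
Lemma reduced_den_inv_graded : graded reduced_den_inv.
Proof.
elim/ltn_ind=> n IHn; rewrite /reduced_den_inv /fps_scale fps_invE eulerian_den0.
rewrite mulVKf ?sub1tvar_neq0 //; apply: reciprocalD.
  case: n {IHn} => [|n]; last exact: reciprocal0.
  by rewrite /= -(rmorph1 cst_t); exact: reciprocal_cst.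
apply/reciprocalN/reciprocal_sum => i.
rewrite reduced_denE mulrCA mulrA.
have := reciprocalM (IHn i (ltn_ord i)) (reduced_den_graded (n - i)%N).
by rewrite subnKC // ltnW.
Qed.

Lemma reduced_denV : fps_mul reduced_den reduced_den_inv =1 fps_monomial 1 0.
Proof.
move=> n; rewrite fps_mulC fps_mul_scale.
rewrite -(@fps_mulVf _ den) ?eulerian_den0 ?sub1tvar_neq0 //.
by apply: eq_fps_mul => // i; rewrite reduced_denE.
Qed.

Lemma eulerian_gfE : eulerian_gf qt tvar 1 =1 fps_mul (qexp qt 1) reduced_den_inv.
Proof. exact: fps_mul_scale. Qed.

(** The splitting [qexp1_split] turns [e(z)] over [reduced_den] into
    [1 + reduced_num / reduced_den]; the 1 only affects [n = 0], where indeed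
    [A_0 = 1] is reciprocal of degree 0 and not -1. *)
Lemma q_eulerian_reciprocal n : reciprocal n (q_eulerian qt tvar n.+1).
Proof.
rewrite /q_eulerian /qr_eulerian qpoch_cst; apply: reciprocalZ.
have -> : eulerian_gf qt tvar 1 n.+1 = fps_mul reduced_num reduced_den_inv n.+1.
  rewrite -[RHS]addr0 -[X in _ + X](reduced_denV n.+1) eulerian_gfE.
  rewrite /fps_mul -big_split; apply: eq_bigr => i _.
  by rewrite qexp1_split mulrDl.
by case: (shift_graded_mul reduced_num_shift_graded reduced_den_inv_graded).
Qed.

Lemma qexp1E n : qexp qt 1 n = (qpoch qt n)^-1.
Proof. by rewrite /qexp expr1n div1r. Qed.

(** Its [z^n] coefficient is [\sum_i t^i / ((q; q)_i (q; q)_(n-i))]. *)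
Lemma qexp_mul_graded : graded (fps_mul (qexp qt 1) (qexp qt tvar)).
Proof.
move=> n; rewrite fps_mulC.
have := @reciprocal_symmetric n
  (fun i => (qpoch qvar i)^-1 * (qpoch qvar (n - i))^-1).
rewrite /fps_mul /qexp; under eq_bigr => i _.
  rewrite (rmorphM cst_t) /= -!qpoch_cstV mulrC mulrA -[X in _ * X]mul1r.
  by rewrite -[X in _ * (X * _)](expr1n _ (n - i)); over.
by apply=> i le_in; rewrite subKn // mulrC.
Qed.

Lemma qpoch_qvar_neq0 n : qpoch qvar n != 0.
Proof.
rewrite /qpoch prodf_seq_neq0; apply/allP => i.
rewrite mem_index_iota => /andP[i_gt0 _] /=.
rewrite subr_eq0 /qvar -tofracXn -tofrac1 tofrac_eq.
apply/eqP => /(congr1 (coefp 0)).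
by rewrite /= coef1 coefXn; case: i i_gt0.
Qed.

(** * The restricted q-Eulerian polynomials *)

Definition first_block (j : nat) : fps Kqt :=
  fps_monomial (q_eulerian qt tvar j.-1 * qt ^+ j.-1 / qpoch qt j.-1) j.-1.

(** For [j = 1] this fails: the monomial is then the constant [A_0 = 1]. *)
Lemma first_block_shift_graded j : (2 <= j)%N -> shift_graded (first_block j).
Proof.
case: j => [|[|j]] // _; split=> // n; rewrite /first_block /fps_monomial /=.
rewrite eqSS; case: eqP => [->|_]; last exact: reciprocal0.
apply: reciprocal_qpochV; rewrite mulrC -(rmorphXn cst_t).
exact/reciprocalZ/q_eulerian_reciprocal.
Qed.

Lemma restricted_gfE j :
  restricted_gf qt tvar j
    =1 fps_mul (first_block j) (fps_mul (qexp qt tvar) reduced_den_inv).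
Proof.
apply: eq_fps_mul => // n; rewrite -fps_mul_scale.
by apply: eq_fps_mul => // i; rewrite /fps_sub /fps_scale mulrBl mul1r.
Qed.

(** The series already vanishes below [z^(j-1)], in agreement with the
    convention [B_n^(j) = 0] for [n < j]. *)
Lemma restricted_eulerianE j n : (0 < j)%N ->
  restricted_eulerian qt tvar j n.+1
    = qpoch qt n * restricted_gf qt tvar j n.
Proof.
case: j => // j _; rewrite /restricted_eulerian ltnS; case: ltnP => // lt_nj.
rewrite /restricted_gf /fps_mul big1 ?mulr0 // => i _.
rewrite /fps_monomial ltn_eqF ?mul0r //.
by rewrite (leq_ltn_trans _ lt_nj) // -ltnS.
Qed.

Lemma qbinom_mul_qpoch N n : (n <= N)%N ->
  cst_t (qbinom qvar N n) * qpoch qt n = qpoch qt N / qpoch qt (N - n).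
Proof.
move=> le_nN; rewrite /qbinom le_nN qpoch_cstV !qpoch_cst.
rewrite -[LHS](rmorphM cst_t) -[RHS](rmorphM cst_t); congr cst_t.
by rewrite invfM mulrA mulfVK // qpoch_qvar_neq0.
Qed.

(** Multiplying a q-exponential generating function by [e(z)] is the
    q-binomial transform of its coefficients; the commutation of the factors
    then gathers the invariant product [e(z) e(tz)]. *)
Lemma restricted_eulerian_transform j N : (0 < j)%N ->
  \sum_(n < N.+1) cst_t (qbinom qvar N n) * restricted_eulerian qt tvar j n.+1
    = qpoch qt N * fps_mul (first_block j)
        (fps_mul (fps_mul (qexp qt 1) (qexp qt tvar)) reduced_den_inv) N.
Proof.
move=> j_gt0; transitivity
  (qpoch qt N * fps_mul (restricted_gf qt tvar j) (qexp qt 1) N).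
  rewrite mulr_sumr; apply: eq_bigr => n _.
  have le_nN : (n <= N)%N by rewrite -ltnS.
  rewrite restricted_eulerianE // qexp1E mulrA qbinom_mul_qpoch //.
  by rewrite mulrAC -mulrA.
congr (_ * _); rewrite fps_mulC.
rewrite (eq_fps_mul (frefl _) (restricted_gfE j)) fps_mulCA.
by apply: eq_fps_mul => // n; rewrite fps_mulA.
Qed.

(** The q-binomial transform [P] of the restricted q-Eulerian polynomials is
    palindromic: the degree falls one short of [N + 1] because
    [first_block j] is [z] times a graded series. *)
Lemma restricted_eulerian_number_symmetry N j a b :
    (2 <= j)%N -> (a + b = N)%N ->
  \sum_(n < N.+2) qbinom qvar N.+1 n * restricted_eulerian_number j n.+1 a
    = \sum_(n < N.+2) qbinom qvar N.+1 n * restricted_eulerian_number j n.+1 b.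
Proof.
move=> j_ge2 abN.
pose p n := poly_part (restricted_eulerian qt tvar j n).
pose P := \sum_(n < N.+2) qbinom qvar N.+1 n *: p n.+1.
have coefP k : P`_k
    = \sum_(n < N.+2) qbinom qvar N.+1 n * restricted_eulerian_number j n.+1 k.
  by rewrite coef_sum; apply: eq_bigr => n _; rewrite coefZ.
rewrite -!coefP; apply: reciprocal_coef abN.
have -> : tofrac P = \sum_(n < N.+2) cst_t (qbinom qvar N.+1 n)
                       * restricted_eulerian qt tvar j n.+1.
  rewrite (rmorph_sum (@tofrac {poly Kq})); apply: eq_bigr => n _ /=.
  rewrite -mul_polyC tofracM /p; congr (_ * _).
  by have [r ->] := restricted_eulerian_poly j n.+1; rewrite poly_partE.
rewrite restricted_eulerian_transform 1?ltnW // qpoch_cst.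
apply: reciprocalZ.
have := graded_mul qexp_mul_graded reduced_den_inv_graded.
by move/(shift_graded_mul (first_block_shift_graded j_ge2)) => [_].
Qed.

Unset Implicit Arguments.

Theorem theorem1 (a b j : nat) (ha : (1 <= a)%N) (hb : (1 <= b)%N)
    (hj : (2 <= j)%N) :
  \sum_(1 <= k < a + b + 3)
     qbinom qvar (a + b + 1) (k - 1) * restricted_eulerian_number j k a
  = \sum_(1 <= k < a + b + 3)
     qbinom qvar (a + b + 1) (k - 1) * restricted_eulerian_number j k b.
Proof.
have reindexE c :
    \sum_(1 <= k < a + b + 3)
      qbinom qvar (a + b + 1) (k - 1) * restricted_eulerian_number j k c
    = \sum_(n < (a + b).+2)
        qbinom qvar (a + b).+1 n * restricted_eulerian_number j n.+1 c.
  rewrite addn3 addn1 big_add1 big_mkord.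
  by apply: eq_bigr => n _; rewrite subn1.
by rewrite !reindexE; exact: restricted_eulerian_number_symmetry.
Qed.
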